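(* Let $n\ge 1$, $m_1,\ldots,m_k\in\mathbb{N}$ with $m_1+\cdots+m_k=n$. For an integer $p$ let $V_p:\{|z|=1\}\to U(n)$, $V_p(z)=\mathrm{diag}(z^p,1,\ldots,1)$, and define $$B_{n,p}(m_1,\ldots,m_k)=\{(f_1,f_2)\mid f_1,f_2\in C(D^2\to M_n(\mathbb{C})),\ f_1(z)=V_p(z)^*f_2(z)V_p(z)\text{ for }|z|=1,\ f_1(0)\in M_{m_1}(\mathbb{C})\oplus\cdots\oplus M_{m_k}(\mathbb{C})\},$$ a $C^*$-algebra under pointwise operations and the sup norm, where $D^2=\{z\in\mathbb{C}:|z|\le1\}$. If $l_1\equiv l_2 \pmod{\gcd(m_1,\ldots,m_k)}$, then $B_{n,l_1}(m_1,\ldots,m_k)\simeq B_{n,l_2}(m_1,\ldots,m_k)$.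
   Context: $B_{n,p}(m_1,\ldots,m_k)$ is the algebra of continuous sections of the algebraic bundle $\mathcal{B}_{n,p}$ over the $2$-sphere with fibre $M_n(\mathbb{C})$ obtained by gluing two closed disks (the two hemispheres) along the equator via the sewing map $V_p$ (acting by $m\mapsto V_p^*mV_p$), whose sections are required to take block-diagonal values (blocks of sizes $m_1,\ldots,m_k$) at a fixed point, taken as the centre $0$ of the first disk. $M_{m_1}(\mathbb{C})\oplus\cdots\oplus M_{m_k}(\mathbb{C})$ denotes the block-diagonal subalgebra of $M_n(\mathbb{C})$. *)

(* Defs.v *)
From HB Require Import structures.
From mathcomp Require Import all_boot all_order all_algebra.
From mathcomp Require Import complex.
From mathcomp Require Import all_classical all_reals all_analysis.
Import numFieldNormedType.Exports.
Import Order.TTheory GRing.Theory Num.Theory.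

Set Implicit Arguments.
Unset Strict Implicit.
Unset Printing Implicit Defensive.

Local Open Scope classical_set_scope.
Local Open Scope ring_scope.

(* The complex numbers, seen as a numClosedFieldType so that the
   analysis library equips them (and matrices over them) with their
   usual topology. *)
Definition Cx (R : realType) : numClosedFieldType := R[i].

Definition disk (R : realType) : set (Cx R) := [set z | `|z| <= 1].
Arguments disk R : clear implicits.

Definition mxstar (R : realType) (n : nat) (A : 'M[Cx R]_n) : 'M[Cx R]_n :=
  map_mx Num.conj A^T.

Definition Vp (R : realType) (n : nat) (p : int) (z : Cx R) : 'M[Cx R]_n :=
  diag_mx (\row_(i < n) (if val i == 0%N then z ^ p else 1)).

Definition psums (m : seq nat) : seq nat :=
  [seq \sum_(x <- take j.+1 m) x | j <- iota 0 (size m)].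

(* Index of the diagonal block (of sizes m_1,...,m_k) containing row/column i:
   i lies in block j (0-based) iff m_1+...+m_j <= i < m_1+...+m_{j+1}. *)
Definition blockidx (m : seq nat) (i : nat) : nat :=
  count (fun s => s <= i)%N (psums m).

Definition block_diag (R : realType) (n : nat) (m : seq nat)
    (A : 'M[Cx R]_n) : Prop :=
  forall i j : 'I_n, blockidx m i <> blockidx m j -> A i j = 0.

Definition gcd_seq (m : seq nat) : nat := foldr gcdn 0%N m.

(* Elements are pairs (f1, f2) of functions D^2 -> M_n(C); a function on
   D^2 is represented by a function on C which vanishes outside D^2. *)
Definition fpair (R : realType) (n : nat) : Type :=
  ((Cx R -> 'M[Cx R]_n) * (Cx R -> 'M[Cx R]_n))%type.

Definition on_disk (R : realType) (n : nat) (f : Cx R -> 'M[Cx R]_n) : Prop :=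
  {within disk R, continuous f} /\ (forall z, ~ disk R z -> f z = 0).

Definition Balg (R : realType) (n : nat) (p : int) (m : seq nat) : set (fpair R n) :=
  [set x | on_disk x.1 /\ on_disk x.2 /\
     (forall z : Cx R, `|z| = 1 ->
        x.1 z = mxstar (Vp n p z) *m x.2 z *m Vp n p z) /\
     block_diag m (x.1 0)].
Arguments Balg R n p m : clear implicits.

Definition padd (R : realType) (n : nat) (x y : fpair R n) : fpair R n :=
  (fun z => x.1 z + y.1 z, fun z => x.2 z + y.2 z).
Definition pscale (R : realType) (n : nat) (c : Cx R) (x : fpair R n) : fpair R n :=
  (fun z => c *: x.1 z, fun z => c *: x.2 z).
Definition pmul (R : realType) (n : nat) (x y : fpair R n) : fpair R n :=
  (fun z => x.1 z *m y.1 z, fun z => x.2 z *m y.2 z).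
Definition pstar (R : realType) (n : nat) (x : fpair R n) : fpair R n :=
  (fun z => mxstar (x.1 z), fun z => mxstar (x.2 z)).

(* *-isomorphism between the C*-algebras A and B (subsets of fpair closed
   under the pointwise operations). *)
Definition star_isomorphic (R : realType) (n : nat) (A B : set (fpair R n)) : Prop :=
  exists phi : fpair R n -> fpair R n,
    (forall x, A x -> B (phi x)) /\
    (forall x y, A x -> A y -> phi x = phi y -> x = y) /\
    (forall y, B y -> exists2 x, A x & phi x = y) /\
    (forall x y, A x -> A y -> phi (padd x y) = padd (phi x) (phi y)) /\
    (forall c x, A x -> phi (pscale c x) = pscale c (phi x)) /\
    (forall x y, A x -> A y -> phi (pmul x y) = pmul (phi x) (phi y)) /\
    (forall x, A x -> phi (pstar x) = pstar (phi x)).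

(* Main.v *)
(* Choose integers c_j with \sum_j c_j m_j = l1 - l2 (Bezout).  Conjugating f1
   by the block-scalar unitary W(z) = diag((z/|z|)^a_i), a_i = c_j on block j,
   preserves continuity at 0, because f1(0) is block diagonal and hence commutes
   with W.  On the circle this changes the sewing map V_l1 into V_l2 up to the
   loop V_l2 W V_l1^* of diagonal matrices, which has determinant 1.  A diagonal
   loop diag(z^b_i) with \sum_i b_i = 0 is a product of loops
   diag(.., z^k, .., z^-k, ..), each of which extends to a continuous unitary
   function U on the plane by a rotation of the two coordinates involved.  The
   isomorphism is (f1, f2) |-> (W f1 W^*, U f2 U^* ).  *)

Require Import Defs.
From HB Require Import structures.
From mathcomp Require Import all_boot all_order all_algebra.
From mathcomp Require Import ring.
From mathcomp Require Import complex.
From mathcomp Require Import all_classical all_reals all_analysis.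
Import numFieldNormedType.Exports.
Import Order.TTheory GRing.Theory Num.Theory.
Local Open Scope classical_set_scope.
Local Open Scope ring_scope.

Set Implicit Arguments.
Unset Strict Implicit.
Unset Printing Implicit Defensive.

(** * Limits of matrix-valued functions *)

Lemma cvg_mxP (K : numFieldType) (m n : nat) (T : Type) (F : set_system T)
    (FF : Filter F) (f : T -> 'M[K]_(m, n)) (A : 'M[K]_(m, n)) :
  f x @[x --> F] --> A <-> forall i j, f x i j @[x --> F] --> A i j.
Proof.
split=> [fA i j | fA].
  exact: (continuous_cvg _ (@coord_continuous K m n i j A) fA).
(* A neighbourhood of [A] contains a product [P] of neighbourhoods of its entries; there are
   finitely many, so the filter meets all these conditions at once. *)
move=> S [P AP PS]; rewrite /nbhs /=.
apply: (@filterS _ F _ (fun x => forall i j, P i j (f x i j))).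
  by move=> x Px; apply: PS.
by apply: filter_forall => i; apply: filter_forall => j; apply: (fA i j); exact: AP.
Qed.

Lemma cvg_mulmx (K : numFieldType) (m n p : nat) (T : Type) (F : set_system T)
    (FF : Filter F) (f : T -> 'M[K]_(m, n)) (g : T -> 'M[K]_(n, p))
    (A : 'M[K]_(m, n)) (B : 'M[K]_(n, p)) :
  f x @[x --> F] --> A -> g x @[x --> F] --> B ->
  f x *m g x @[x --> F] --> A *m B.
Proof.
move=> /cvg_mxP fA /cvg_mxP gB; apply/cvg_mxP => i j; rewrite mxE.
under eq_fun do rewrite mxE.
apply: cvg_big => [|k _]; first exact: add_continuous.
exact: cvgM.
Qed.

Lemma cvg_exprn (K : numFieldType) (T : Type) (F : set_system T)
    (FF : Filter F) (f : T -> K) (a : K) (p : nat) :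
  f x @[x --> F] --> a -> f x ^+ p @[x --> F] --> a ^+ p.
Proof.
move=> fa; elim: p => [|p IHp].
  by rewrite expr0; under eq_fun do rewrite expr0; exact: cvg_cst.
by rewrite exprS; under eq_fun do rewrite exprS; exact: cvgM.
Qed.

Lemma cvg_conjC (C : numClosedFieldType) (T : Type) (F : set_system T)
    (FF : Filter F) (f : T -> C) (a : C) :
  f x @[x --> F] --> a -> (f x)^* @[x --> F] --> a^*.
Proof.
move=> fa; apply/(@cvgrPdist_lt C C^o) => e e0.
move/(@cvgrPdist_lt C C^o)/(_ e e0) : fa; apply: filterS => x.
by rewrite -rmorphB norm_conjC.
Qed.

(** * Adjoints *)

Section Adjmx.
Variables (C : numClosedFieldType) (n : nat).
Implicit Types A B : 'M[C]_n.

(** Convertible to [mxstar] when the field is [Cx R]. *)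
Definition adjmx A : 'M[C]_n := map_mx Num.conj A^T.

Lemma adjmx_mul A B : adjmx (A *m B) = adjmx B *m adjmx A.
Proof. by rewrite /adjmx trmx_mul map_mxM. Qed.

Lemma adjmxK : involutive adjmx.
Proof. by move=> A; apply/matrixP => i j; rewrite !mxE conjCK. Qed.

Lemma adjmx1 : adjmx (1%:M : 'M[C]_n) = 1%:M.
Proof. by rewrite /adjmx trmx1 map_mx1. Qed.

Lemma adjmxD A B : adjmx (A + B) = adjmx A + adjmx B.
Proof. by rewrite /adjmx linearD map_mxD. Qed.

Lemma cvg_adjmx (T : Type) (F : set_system T) (FF : Filter F)
    (f : T -> 'M[C]_n) (A : 'M[C]_n) :
  f x @[x --> F] --> A -> adjmx (f x) @[x --> F] --> adjmx A.
Proof.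
move=> /cvg_mxP fA; apply/cvg_mxP => i j; rewrite !mxE.
under eq_fun do rewrite !mxE.
exact: cvg_conjC (fA j i).
Qed.

End Adjmx.

(** * Diagonal loops, recorded by their integer exponent vectors *)

Definition diagX (C : numClosedFieldType) (n : nat) (a : 'rV[int]_n) (z : C) :
  'M[C]_n := diag_mx (\row_i z ^ a 0 i).

Lemma diagX0 (C : numClosedFieldType) (n : nat) (z : C) :
  diagX (0 : 'rV[int]_n) z = 1%:M.
Proof.
rewrite /diagX -diag_const_mx; congr diag_mx.
by apply/rowP => i; rewrite !mxE expr0z.
Qed.

Lemma diagXD (C : numClosedFieldType) (n : nat) (a b : 'rV[int]_n) (z : C) :
  z != 0 -> diagX (a + b) z = diagX a z *m diagX b z.
Proof.
move=> z0; rewrite /diagX mulmx_diag; congr diag_mx.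
by apply/rowP => i; rewrite !mxE expfzDr.
Qed.

Lemma normrz_exp1 (C : numClosedFieldType) (k : int) (z : C) :
  `|z| = 1 -> `|z ^ k| = 1.
Proof.
move=> z1; case: k => p; first by rewrite -exprnP normrX z1 expr1n.
by rewrite NegzE -exprnN normfV normrX z1 expr1n invr1.
Qed.

Lemma conjC_exprz (C : numClosedFieldType) (k : int) (z : C) :
  `|z| = 1 -> (z ^ k)^* = z ^ (- k).
Proof.
move=> z1; rewrite -invr_expz invC_norm normrz_exp1 //.
by rewrite expr1n invr1 mul1r.
Qed.

Lemma adjmx_diagX (C : numClosedFieldType) (n : nat) (a : 'rV[int]_n) (z : C) :
  `|z| = 1 -> adjmx (diagX a z) = diagX (- a) z.
Proof.
move=> z1; rewrite /adjmx /diagX tr_diag_mx map_diag_mx; congr diag_mx.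
by apply/rowP => i; rewrite !mxE; exact: conjC_exprz.
Qed.

(** Negative powers blow up near the origin, but on the circle the inverse of [z] is its conjugate,
    whose powers are continuous everywhere. Off the circle [q] may have any modulus; [rot2] accepts
    every complex number. *)
Lemma exprz_extends (C : numClosedFieldType) (k : int) :
  exists2 q : C -> C, (forall z, q x @[x --> nbhs z] --> q z) &
    forall z, `|z| = 1 -> q z = z ^ k.
Proof.
case: k => p.
  by exists (fun z => z ^+ p) => // z; apply: cvg_exprn; exact: cvg_id.
exists (fun z => z^* ^+ p.+1).
  by move=> z; apply: cvg_exprn; apply: cvg_conjC; exact: cvg_id.
by move=> z z1; rewrite NegzE -(conjC_exprz _ z1) -exprnP rmorphXn.
Qed.

(** * A unitary 2 by 2 matrix depending on a complex parameter *)

Section Rot2.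
Variable C : numClosedFieldType.
Implicit Types q : C.

(* The first column [(w, s)] is the inverse stereographic projection of [q],
   a point of the unit sphere of [C * R] lying on the equator [s = 0] exactly
   when [|q| = 1]. *)
Definition rot2 q : 'M[C]_2 :=
  \matrix_(i, j)
    if i == 0 then (if j == 0 then 2 * q else q * q^* - 1) / (1 + q * q^*)
    else (if j == 0 then 1 - q * q^* else 2 * q^*) / (1 + q * q^*).

Lemma rot2_den_neq0 q : 1 + q * q^* != 0.
Proof. by rewrite lt0r_neq0 // ltr_pwDl ?ltr01 // mul_conjC_ge0. Qed.

(** The rows have norm one because [4|q|^2 + (|q|^2 - 1)^2 = (|q|^2 + 1)^2]; the opposite signs off
    the diagonal make them orthogonal. *)
Lemma rot2_unitary q : rot2 q *m adjmx (rot2 q) = 1%:M.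
Proof.
have d0 := rot2_den_neq0 q.
apply/matrixP => i j; rewrite !mxE !big_ord_recl big_ord0 !mxE /=.
case: i => [[|[|//]] i2]; case: j => [[|[|//]] j2] => /=;
  rewrite !(fmorphV, rmorphM, rmorphD, rmorphN, rmorph1, rmorph_nat) /= !conjCK;
  by rewrite ![q^* * q]mulrC; field.
Qed.

(** On the equator the off-diagonal entries vanish and the denominator is 2, which leaves a diagonal
    matrix of determinant 1. *)
Lemma rot2_circle q : `|q| = 1 ->
  rot2 q = \matrix_(i, j) ((if i == 0 then q else q^*) *+ (i == j)).
Proof.
move=> q1; have qq : q * q^* = 1 by rewrite -normCK q1 expr1n.
have t0 : (2 : C) != 0 by rewrite pnatr_eq0.
apply/matrixP => i j; rewrite !mxE qq subrr -[1 + 1](mulr2n 1).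
case: i => [[|[|//]] i2]; case: j => [[|[|//]] j2] /=;
  by rewrite ?mul0r // mulr1n mulrAC divff ?mul1r.
Qed.

Lemma cvg_rot2 (T : Type) (F : set_system T) (FF : Filter F)
    (q : T -> C) (a : C) :
  q x @[x --> F] --> a -> rot2 (q x) @[x --> F] --> rot2 a.
Proof.
move=> qa; have qqa : q x * (q x)^* @[x --> F] --> a * a^*.
  by apply: cvgM => //; exact: cvg_conjC.
have da : (1 + q x * (q x)^*)^-1 @[x --> F] --> (1 + a * a^*)^-1.
  apply: cvgV; first exact: rot2_den_neq0.
  by apply: cvgD => //; exact: cvg_cst.
apply/cvg_mxP => i j; rewrite !mxE; under eq_fun do rewrite !mxE.
case: (i == 0); case: (j == 0); (apply: cvgM => //).
- by apply: cvgM => //; exact: cvg_cst.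
- by apply: cvgB => //; exact: cvg_cst.
- by apply: cvgB => //; exact: cvg_cst.
- by apply: cvgM; [exact: cvg_cst | exact: cvg_conjC].
Qed.

End Rot2.

(** * Acting on two chosen coordinates *)

Section Embed2.
Variables (C : numClosedFieldType) (n : nat) (i j : 'I_n).
Hypothesis ij : i != j.
Implicit Types A B : 'M[C]_2.

Definition pair_mx : 'M[C]_(2, n) :=
  \matrix_(k, l) (l == if k == 0 then i else j)%:R.

Lemma pair_mxK : pair_mx *m pair_mx^T = 1%:M.
Proof.
apply/matrixP => k l; rewrite !mxE.
rewrite (bigD1 (if k == 0 then i else j)) //= !mxE eqxx mul1r big1 ?addr0.
  case: k => [[|[|//]] k2]; case: l => [[|[|//]] l2] => //=.
  - by rewrite eqxx.
  - by rewrite (negPf ij).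
  - by rewrite eq_sym (negPf ij).
  - by rewrite eqxx.
by move=> h /negPf hk; rewrite !mxE hk mul0r.
Qed.

(** [B] acts on coordinates [i] and [j], the identity on the others. In this form the algebra rests
    on [pair_mxK] alone, without cases on indices. *)
Definition embed2 B : 'M[C]_n := 1%:M + pair_mx^T *m (B - 1%:M) *m pair_mx.

Lemma embed2_mul A B : embed2 (A *m B) = embed2 A *m embed2 B.
Proof.
rewrite /embed2 mulmxDl mul1mx mulmxDr mulmx1 -addrA; congr (_ + _).
rewrite -!mulmxA (mulmxA pair_mx) pair_mxK mul1mx !mulmxA.
rewrite -!(mulmxDl, mulmxDr); congr (_ *m _).
rewrite -mulmxA -!mulmxDr; congr (_ *m _).
(* The remaining identity, restated with the ring product so that ring lemmas apply. *)
change (A * B - 1 = B - 1 + (A - 1 + (A - 1) * (B - 1))).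
rewrite [X in _ + (_ + X)]mulrBl mul1r mulrBr mulr1 [RHS]addrC -addrA subrK.
by rewrite [RHS]addrC -addrA addKr.
Qed.

Lemma embed2_1 : embed2 1%:M = 1%:M.
Proof. by rewrite /embed2 subrr mulmx0 mul0mx addr0. Qed.

Lemma adjmx_embed2 B : adjmx (embed2 B) = embed2 (adjmx B).
Proof.
have starP : map_mx Num.conj pair_mx = pair_mx.
  by apply/matrixP => k l; rewrite !mxE rmorph_nat.
rewrite /embed2 adjmxD adjmx1; congr (_ + _).
rewrite /adjmx !trmx_mul trmxK !map_mxM -!map_trmx starP mulmxA.
congr (_ *m _ *m _).
by rewrite map_mxB map_mx1 linearB /= trmx1 map_trmx.
Qed.

Lemma cvg_embed2 (T : Type) (F : set_system T) (FF : Filter F)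
    (f : T -> 'M[C]_2) (B : 'M[C]_2) :
  f x @[x --> F] --> B -> embed2 (f x) @[x --> F] --> embed2 B.
Proof.
move=> fB; apply: cvgD; first exact: cvg_cst.
apply: cvg_mulmx; last exact: cvg_cst.
apply: cvg_mulmx; first exact: cvg_cst.
by apply: cvgB => //; exact: cvg_cst.
Qed.

End Embed2.

(** * Extending diagonal loops of total degree zero *)

Section CircleExtends.
Variables (C : numClosedFieldType) (n : nat).
Implicit Types a b : 'rV[int]_n.

(** Null-homotopy of the loop in the unitary group, witnessed by an explicit extension. The property
    is additive in [a], so generators suffice. *)
Definition circle_extends a : Prop := exists U : C -> 'M[C]_n,
  [/\ forall z, U x @[x --> nbhs z] --> U z,
      forall z, U z *m adjmx (U z) = 1%:M &
      forall z, `|z| = 1 -> U z = diagX a z].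

Lemma circle_extends0 : circle_extends 0.
Proof.
exists (fun=> 1%:M); split=> [z|z|z _]; first exact: cvg_cst.
  by rewrite adjmx1 mulmx1.
by rewrite diagX0.
Qed.

Lemma circle_extendsD a b :
  circle_extends a -> circle_extends b -> circle_extends (a + b).
Proof.
move=> [U [cU uU Ua]] [V [cV uV Vb]].
exists (fun z => U z *m V z); split=> [z|z|z z1].
- exact: cvg_mulmx.
- by rewrite adjmx_mul mulmxA -(mulmxA (U z)) uV mulmx1.
- by rewrite Ua // Vb // -diagXD // -normr_eq0 z1 oner_eq0.
Qed.

(** [rot2], applied in coordinates [i] and [j] to an extension of [z^k], restricts on the circle to
    the entries [z^k] and [z^-k]. *)
Lemma circle_extends_pair (k : int) (i j : 'I_n) :
  circle_extends (k *: (delta_mx 0 i - delta_mx 0 j)).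
Proof.
have [->|ij] := eqVneq i j; first by rewrite subrr scaler0; exact: circle_extends0.
have [q cq qX] := exprz_extends C k.
exists (fun z => embed2 i j (rot2 (q z))); split=> [z|z|z z1].
- by apply: cvg_embed2; exact: cvg_rot2.
- by rewrite adjmx_embed2 -embed2_mul // rot2_unitary embed2_1.
have q1 : `|q z| = 1 by rewrite qX // normrz_exp1.
rewrite rot2_circle // qX // conjC_exprz //.
apply/matrixP => r s; rewrite !mxE !big_ord_recl big_ord0 !mxE /=.
rewrite !big_ord_recl !big_ord0 !mxE /= !mulr1n !mulr0n subr0.
rewrite !(mulr0, addr0, add0r).
have [->|rs] := eqVneq r s.
  have [->|_] := eqVneq s i.
    by rewrite (negPf ij) !(mul1r, mulr1, mul0r, mulr0, addr0, subr0) addrC subrK.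
  have [_|_] := eqVneq s j; last by rewrite !(mul0r, subr0, mulr0, addr0).
  by rewrite sub0r mulrN1 !(mul1r, mulr1, mul0r, mulr0, add0r) addrC subrK.
(* Off the diagonal, [r] and [s] cannot both equal [l]. *)
have off l x : (r == l)%:R * x * (s == l)%:R = 0 :> C.
  have [<-|_] := eqVneq r l; last by rewrite !mul0r.
  by rewrite eq_sym (negPf rs) mulr0.
by rewrite !off !addr0 !mulr0n.
Qed.

(** As the exponents sum to zero, subtracting the basis vector at [i0] from every basis vector does
    not change the expansion of [a], which becomes a sum of pair loops. *)
Lemma circle_extends_sum0 a (i0 : 'I_n) :
  \sum_i a 0 i = 0 -> circle_extends a.
Proof.
move=> a0; have -> : a = \sum_i a 0 i *: (delta_mx 0 i - delta_mx 0 i0).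
  under eq_bigr do rewrite scalerBr.
  by rewrite sumrB -scaler_suml a0 scale0r subr0 -row_sum_delta.
apply: big_ind => [|b c|i _].
- exact: circle_extends0.
- exact: circle_extendsD.
- exact: circle_extends_pair.
Qed.

End CircleExtends.

(** * Conjugation by phases, at the origin and on the equator *)

Section Phase.
Variable C : numClosedFieldType.

(* The value at [0] is arbitrary; it is taken on the unit circle so that
   [diagX a (phase z)] is always unitary. *)
Definition phase (z : C) : C := if z == 0 then 1 else z / `|z|.

Lemma norm_phase z : `|phase z| = 1.
Proof.
rewrite /phase; case: eqVneq => [_|z0]; first exact: normr1.
by rewrite normf_div normr_id divff // normr_eq0.
Qed.

Lemma phase_neq0 z : phase z != 0.
Proof. by rewrite -normr_eq0 norm_phase oner_eq0. Qed.

Lemma phase_circle z : `|z| = 1 -> phase z = z.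
Proof. by move=> z1; rewrite /phase -normr_eq0 z1 oner_eq0 divr1. Qed.

Lemma cvg_exprz (T : Type) (F : set_system T) (FF : Filter F)
    (f : T -> C) (a : C) (k : int) :
  a != 0 -> f x @[x --> F] --> a -> f x ^ k @[x --> F] --> a ^ k.
Proof.
move=> a0 fa; case: k => p; first exact: cvg_exprn.
by apply: (cvgV (expf_neq0 _ a0)); exact: cvg_exprn.
Qed.

Variables (F : set_system C) (FF : Filter F) (z : C).
Hypothesis Fz : x @[x --> F] --> z.

Lemma cvg_phase : z != 0 -> phase x @[x --> F] --> phase z.
Proof.
move=> z0; have cq : x / `|x| @[x --> F] --> z / `|z|.
  apply: cvgM => //; apply: cvgV; first by rewrite normr_eq0.
  exact: (@cvg_norm C C^o).
rewrite /phase (negPf z0); apply: cvg_trans cq; apply: near_eq_cvg.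
have F0 : \forall x \near F, x != 0 by exact: (@cvgr_neq0 C C^o _ F FF id z).
by apply: filterS F0 => x /negPf ->.
Qed.

(* At the origin the phases of an entry either cancel ([a i = a j]) or
   multiply a function tending to [0]. *)
Lemma cvg_phase_conj (n : nat) (a : 'rV[int]_n) (f : C -> 'M[C]_n) :
  (z = 0 -> forall i j, a 0 i <> a 0 j -> f 0 i j = 0) ->
  f x @[x --> F] --> f z ->
  diagX a (phase x) *m f x *m adjmx (diagX a (phase x)) @[x --> F] -->
  diagX a (phase z) *m f z *m adjmx (diagX a (phase z)).
Proof.
move=> f0 /cvg_mxP fz; apply/cvg_mxP => i j.
have E x : (diagX a (phase x) *m f x *m adjmx (diagX a (phase x))) i j =
    phase x ^ a 0 i * f x i j * phase x ^ (- a 0 j).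
  by rewrite adjmx_diagX ?norm_phase // mul_mx_diag mul_diag_mx !mxE.
rewrite E; under eq_fun do rewrite E.
have [z0|z0] := eqVneq z 0; last first.
  by apply: cvgM; [apply: cvgM => //|]; apply: cvg_exprz;
    rewrite ?phase_neq0 //; exact: cvg_phase.
have [aij|/eqP aij] := eqVneq (a 0 i) (a 0 j).
  have E2 x : phase x ^ a 0 i * f x i j * phase x ^ (- a 0 j) = f x i j.
    by rewrite mulrAC aij -expfzDr ?phase_neq0 // subrr expr0z mul1r.
  rewrite E2; under eq_fun do rewrite E2.
  exact: fz.
move: (fz i j); rewrite z0 (f0 z0 _ _ aij) mulr0 mul0r.
move=> /(@cvg_norm C C^o); rewrite normr0 => n0.
apply: (@norm_cvg0 C C^o).
under eq_fun do rewrite !normrM !normrz_exp1 ?norm_phase // mul1r mulr1.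
exact: n0.
Qed.

End Phase.

(** Exponents add, so both sides equal [diagX (a - b) z *m M *m diagX (b - a) z]. This singles out
    [c + a - b] as the loop to be extended over the second disk. *)
Lemma conj_glue (C : numClosedFieldType) (n : nat) (a b c : 'rV[int]_n)
    (z : C) (M : 'M[C]_n) : `|z| = 1 ->
  diagX a z *m (adjmx (diagX b z) *m M *m diagX b z) *m adjmx (diagX a z) =
  adjmx (diagX c z) *m
    (diagX (c + a - b) z *m M *m adjmx (diagX (c + a - b) z)) *m diagX c z.
Proof.
move=> z1; have z0 : z != 0 by rewrite -normr_eq0 z1 oner_eq0.
rewrite !adjmx_diagX //.
have L (p q r s : 'rV[int]_n) :
    diagX p z *m (diagX q z *m M *m diagX r z) *m diagX s z =
    diagX (p + q) z *m M *m diagX (r + s) z.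
  by rewrite !diagXD // !mulmxA.
rewrite !L; congr (diagX _ _ *m _ *m diagX _ _).
  by rewrite -addrA addKr.
by rewrite opprB opprD -addrA (addrAC (- c)) addNr add0r.
Qed.

Lemma diagX_unitary (C : numClosedFieldType) (n : nat) (a : 'rV[int]_n)
    (z : C) : `|z| = 1 -> diagX a z *m adjmx (diagX a z) = 1%:M.
Proof.
move=> z1; rewrite adjmx_diagX // -diagXD; first by rewrite subrr diagX0.
by rewrite -normr_eq0 z1 oner_eq0.
Qed.

(** * Block indices and Bezout coefficients *)

Lemma blockidx_cons (x : nat) (m : seq nat) (i : nat) :
  blockidx (x :: m) i = if (i < x)%N then 0%N else (blockidx m (i - x)).+1.
Proof.
rewrite /blockidx.
(* The old partial sums are shifted by [x]; the extra 0, the empty sum, yields the new first one. *)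
have -> : psums (x :: m) = [seq (x + s)%N | s <- 0%N :: psums m].
  rewrite /psums /= big_cons take0 big_nil; congr cons.
  rewrite -[1%N]/(1 + 0)%N iotaDl -!map_comp; apply: eq_map => j /=.
  by rewrite big_cons.
rewrite count_map /= addn0; case: ltnP => [ix|xi].
  by rewrite add0n (eq_count (a2 := pred0)) ?count_pred0 // => s /=;
    rewrite leqNgt ltn_addr.
by rewrite add1n; congr S; apply: eq_count => s /=; rewrite -leq_subRL.
Qed.

(** The sum counts each block value as often as the block is long, so it is an integer combination
    of the sizes; Bezout is applied one block at a time. *)
Lemma sum_blockidx (m : seq nat) (d : int) :
  ((gcd_seq m)%:Z %| d)%Z ->
  exists c : nat -> int, \sum_(0 <= i < \sum_(x <- m) x) c (blockidx m i) = d.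
Proof.
elim: m d => [|x m IHm] d.
  by rewrite dvd0z => /eqP ->; exists (fun=> 0); rewrite big_nil big_geq.
move=> /dvdzP[k ->]; have [u [v uv]] := Bezoutz x%:Z (gcd_seq m)%:Z.
have [|c cE] := IHm (k * v * (gcd_seq m)%:Z); first exact: dvdz_mull.
(* In [k] times the Bezout relation, the first block contributes [k * u * x] and the others, by
   induction, [k * v * gcd_seq m]. *)
exists (fun j => if j is j'.+1 then c j' else k * u).
rewrite big_cons (big_cat_nat (n := x)) ?leq_addr //=.
rewrite (eq_big_nat _ _ (F2 := fun=> k * u)); last first.
  by move=> i /andP[_ ix]; rewrite blockidx_cons ix.
rewrite -{2}[x]add0n big_addn addKn.
rewrite [X in _ + X](eq_big_nat _ _ (F2 := fun i => c (blockidx m i))); last first.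
  by move=> i _; rewrite blockidx_cons ltnNge leq_addl addnK.
rewrite cE sumr_const_nat subn0 /gcd_seq /= -/(gcd_seq m).
have -> : (gcdn x (gcd_seq m))%:Z = u * x%:Z + v * (gcd_seq m)%:Z by rewrite uv.
by rewrite mulrDr !mulrA -mulr_natr natz.
Qed.

(** * The isomorphism by conjugation *)

Section ConjIso.
Variables (R : realType) (n : nat).
Implicit Types (a : 'rV[int]_n) (U : Cx R -> 'M[Cx R]_n).

Definition conj_pair a U (x : fpair R n) : fpair R n :=
  (fun z => diagX a (phase z) *m x.1 z *m adjmx (diagX a (phase z)),
   fun z => U z *m x.2 z *m adjmx (U z)).

Definition firstX (p : int) : 'rV[int]_n :=
  \row_i (if val i == 0%N then p else 0).

Lemma VpE (p : int) (z : Cx R) : Vp n p z = diagX (firstX p) z.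
Proof.
rewrite /Vp /diagX; congr diag_mx; apply/rowP => i; rewrite !mxE.
by case: ifP => // _; rewrite expr0z.
Qed.

(** The exponents [a] differ only between blocks, where the first function vanishes at 0, so
    continuity survives at the origin. The general [a] and [U] let the lemma serve the inverse map
    too. *)
Lemma conj_pair_Balg (l1 l2 : int) (m : seq nat) a U :
  (forall i j, a 0 i <> a 0 j -> blockidx m i <> blockidx m j) ->
  (forall z, U x @[x --> nbhs z] --> U z) ->
  (forall z, `|z| = 1 -> U z = diagX (firstX l2 + a - firstX l1) z) ->
  forall x, Balg R n l1 m x -> Balg R n l2 m (conj_pair a U x).
Proof.
move=> am cU Ua [f g] [[cf f0] [[cg g0] [glue bd]]].
move: f0 g0 glue bd => /= f0 g0 glue bd.
split; [|split; [|split]] => /=.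
- split=> [|z /f0 ->]; last by rewrite mulmx0 mul0mx.
  apply/subspace_continuousP => z dz; apply: cvg_phase_conj.
  + exact: cvg_within.
  + by move=> _ i j aij; apply: bd; exact: am.
  + exact: (subspace_continuousP _ _).1 cf z dz.
- split=> [|z /g0 ->]; last by rewrite mulmx0 mul0mx.
  apply/subspace_continuousP => z dz.
  have cUw : U x @[x --> within (disk R) (nbhs z)] --> U z.
    exact: cvg_within_filter.
  apply: cvg_mulmx; last exact: cvg_adjmx.
  apply: cvg_mulmx; first exact: cUw.
  exact: (subspace_continuousP _ _).1 cg z dz.
- move=> z z1; rewrite (glue _ z1) !VpE (Ua _ z1) (phase_circle z1).
  exact: (conj_glue _ _ _ _ z1).
(* Diagonal conjugation rescales each entry, so zeros outside the blocks persist. *)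
- move=> i j ij; rewrite (adjmx_diagX _ (norm_phase 0)) mul_mx_diag mul_diag_mx !mxE.
  by rewrite (bd i j ij) mulr0 mul0r.
Qed.

End ConjIso.

Theorem theorem2 (R : realType) (n : nat) (m : seq nat) (l1 l2 : int) :
  (1 <= n)%N -> (\sum_(x <- m) x)%N = n ->
  (l1 = l2 %[mod (gcd_seq m)%:Z])%Z ->
  star_isomorphic (Balg R n l1 m) (Balg R n l2 m).
Proof.
move=> n0 mn /eqP; rewrite eqz_mod_dvd => /sum_blockidx[c cE].
pose a : 'rV[int]_n := \row_i c (blockidx m i).
(* Exponents of the loop [V_l2 W V_l1^*]; they sum to [l2 + (l1 - l2) - l1 = 0]. *)
pose b := firstX n l2 + a - firstX n l1.
have am i j : a 0 i <> a 0 j -> blockidx m i <> blockidx m j.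
  by rewrite !mxE => cij bij; apply: cij; rewrite bij.
have sum_firstX l : \sum_i firstX n l 0 i = l.
  rewrite (bigD1 (Ordinal n0)) //= mxE /= big1 ?addr0 // => i i0.
  by rewrite mxE -[0%N]/(val (Ordinal n0)) (inj_eq val_inj) (negPf i0).
have b0 : \sum_i b 0 i = 0.
  have -> : \sum_i b 0 i = \sum_i (firstX n l2 0 i + a 0 i - firstX n l1 0 i).
    by apply: eq_bigr => i _; rewrite !mxE.
  rewrite sumrB big_split /= !sum_firstX; under eq_bigr do rewrite mxE.
  by move: cE; rewrite mn big_mkord => ->; rewrite addrCA subrr addr0 subrr.
have [U [cU uU Ub]] := circle_extends_sum0 (Cx R) (Ordinal n0) b0.
have uW z : diagX a (phase z : Cx R) *m adjmx (diagX a (phase z)) = 1%:M.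
  exact: diagX_unitary (norm_phase z).
have [uU' uW'] : (forall z, adjmx (U z) *m U z = 1%:M) /\
    (forall z : Cx R, adjmx (diagX a (phase z)) *m diagX a (phase z) = 1%:M).
  by split=> z; apply: mulmx1C.
(* The inverse map conjugates by the adjoints; since phases have modulus 1, this replaces [a] by
   [- a]. *)
pose U' z := adjmx (U z).
have phiK : cancel (conj_pair a U) (conj_pair (- a) U').
  move=> [f g]; rewrite /conj_pair /=; congr pair; apply/funext => z.
    rewrite -(adjmx_diagX _ (norm_phase z)) adjmxK.
    by rewrite !mulmxA uW' mul1mx -mulmxA uW' mulmx1.
  by rewrite /U' adjmxK !mulmxA uU' mul1mx -mulmxA uU' mulmx1.
have phi'K : cancel (conj_pair (- a) U') (conj_pair a U).
  move=> [f g]; rewrite /conj_pair /=; congr pair; apply/funext => z.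
    rewrite -(adjmx_diagX _ (norm_phase z)) adjmxK.
    by rewrite !mulmxA uW mul1mx -mulmxA uW mulmx1.
  by rewrite /U' adjmxK !mulmxA uU mul1mx -mulmxA uU mulmx1.
exists (conj_pair a U); split; [|split; [|split; [|split; [|split; [|split]]]]].
- exact: conj_pair_Balg.
- by move=> x y _ _ /(can_inj phiK).
- move=> y By; exists (conj_pair (- a) U' y); last exact: phi'K.
  (* With [l1] and [l2] exchanged, the required loop has exponents [- b], those of [U'] on the
     circle. *)
  refine (@conj_pair_Balg R n l2 l1 m (- a) U' _ _ _ y By) => [i j|z|z z1].
  + by rewrite !mxE => /eqP; rewrite eqr_opp => /eqP cij bij; apply: cij; rewrite bij.
  + exact: cvg_adjmx.
  + by rewrite /U' (Ub _ z1) (adjmx_diagX _ z1) /b !opprD opprK addrC addrA addrAC.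
- move=> [f g] [f' g'] _ _; rewrite /conj_pair /padd /=.
  by congr pair; apply/funext => z; rewrite mulmxDr mulmxDl.
- move=> k [f g] _; rewrite /conj_pair /pscale /=.
  by congr pair; apply/funext => z; rewrite -scalemxAr -scalemxAl.
- move=> [f g] [f' g'] _ _; rewrite /conj_pair /pmul /=.
  congr pair; apply/funext => z; rewrite !mulmxA; congr (_ *m _ *m _).
    by rewrite -[_ *m _ *m _ in RHS]mulmxA uW' mulmx1.
  by rewrite -[_ *m _ *m _ in RHS]mulmxA uU' mulmx1.
- move=> [f g] _; rewrite /conj_pair /pstar /=.
  by congr pair; apply/funext => z; rewrite -![mxstar _]/(adjmx _) !adjmx_mul adjmxK mulmxA.
Qed.
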